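(* Let $\phi=\tilde p/p$ be a degree $(n,1)$ rational inner function as in the context and let $\alpha\in\mathbb{T}$. Then: (i) $B_\alpha$ is a finite Blaschke product; (ii) if $\alpha$ is a generic value for $\phi$, then $B_\alpha$ has degree $n$ and $\mathcal{C}_\alpha=E_\alpha$; (iii) if $\alpha$ is an exceptional value and, after reordering, $\phi^*(\tau_k,\lambda_k)=\alpha$ exactly for $k=1,\dots,\ell$, then $B_\alpha$ has degree $n-\ell$ and $\mathcal{C}_\alpha=E_\alpha\cup L_1\cup\cdots\cup L_\ell$.
   Context: $\mathbb{D}$ is the open unit disk, $\mathbb{T}$ the unit circle. Fix $n\ge1$. Let $p\in\mathbb{C}[z_1,z_2]$ have no zeros on $\mathbb{D}^2$, degree at most $n$ in $z_1$ and at most $1$ in $z_2$; write $p(z)=p_1(z_1)+z_2p_2(z_1)$. Set $\tilde p(z)=z_1^nz_2\overline{p(1/\bar z_1,1/\bar z_2)}=z_2\tilde p_1(z_1)+\tilde p_2(z_1)$ with $\tilde p_i(z)=z^n\overline{p_i(1/\bar z)}$. Assume $\tilde p$ has degree exactly $(n,1)$ and $p,\tilde p$ have no common factor, so $\phi=\tilde p/p$ is a degree $(n,1)$ rational inner function. The zeros of $p$ on $\mathbb{T}^2$ are distinct points $(\tau_1,\lambda_1),\dots,(\tau_m,\lambda_m)$; the non-tangential limit $\phi^*$ exists and is unimodular at every point of $\mathbb{T}^2$. $\alpha\in\mathbb{T}$ is exceptional if $\phi^*(\tau_k,\lambda_k)=\alpha$ for some $k$, generic otherwise. $B_\alpha$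 is the rational function $\frac{\tilde p_1(z)-\alpha p_2(z)}{\alpha p_1(z)-\tilde p_2(z)}$ with common factors cancelled; $E_\alpha=\{(\zeta,\overline{B_\alpha(\zeta)}):\zeta\in\mathbb{T}\}$; $L_k=\{\tau_k\}\times\mathbb{T}$; $\mathcal{C}_\alpha=\{\zeta\in\mathbb{T}^2:\tilde p(\zeta)=\alpha p(\zeta)\}$. *)

(* Defs.v *)
From HB Require Import structures.
From mathcomp Require Import all_boot all_order all_algebra.
From mathcomp Require Import complex.
From mathcomp Require Import reals.
Set Implicit Arguments. Unset Strict Implicit. Unset Printing Implicit Defensive.
Import Order.TTheory GRing.Theory Num.Theory.
Local Open Scope ring_scope.

Section RIF.
Variable R : realType.
Local Notation C := R[i].

(* reflection q~(z) = z^n conj(q(1/conj z)), coefficientwise (for size q <= n+1) *)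
Definition refl (n : nat) (q : {poly C}) : {poly C} :=
  \poly_(i < n.+1) (q`_(n - i))^*.

Definition peval (p1 p2 : {poly C}) (z1 z2 : C) : C := p1.[z1] + z2 * p2.[z1].

(* p as an element of C[z1][z2] *)
Definition bipoly (p1 p2 : {poly C}) : {poly {poly C}} := p1%:P + 'X * p2%:P.

Definition no_common_factor (P Q : {poly {poly C}}) : Prop :=
  forall d r s : {poly {poly C}}, P = d * r -> Q = d * s ->
    exists c : C, d = c%:P%:P.

(* phi = p~ / p with p~ = z2 p~1 + p~2 *)
Definition phi (n : nat) (p1 p2 : {poly C}) (z1 z2 : C) : C :=
  peval (refl n p2) (refl n p1) z1 z2 / peval p1 p2 z1 z2.

Definition ntlim (f : C -> C -> C) (w1 w2 L : C) : Prop :=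
  forall c eps : C, 1 < c -> 0 < eps ->
  exists2 delta : C, 0 < delta &
    forall z1 z2 : C, `|z1| < 1 -> `|z2| < 1 ->
      `|z1 - w1| < c * (1 - `|z1|) -> `|z2 - w2| < c * (1 - `|z2|) ->
      `|z1 - w1| < delta -> `|z2 - w2| < delta ->
      `|f z1 z2 - L| < eps.

Definition Bnum0 n (alpha : C) (p1 p2 : {poly C}) := refl n p1 - alpha *: p2.
Definition Bden0 n (alpha : C) (p1 p2 : {poly C}) := alpha *: p1 - refl n p2.
Definition Bnum n alpha p1 p2 :=
  Bnum0 n alpha p1 p2 %/ gcdp (Bnum0 n alpha p1 p2) (Bden0 n alpha p1 p2).
Definition Bden n alpha p1 p2 :=
  Bden0 n alpha p1 p2 %/ gcdp (Bnum0 n alpha p1 p2) (Bden0 n alpha p1 p2).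
Definition Bval n alpha p1 p2 (z : C) : C :=
  (Bnum n alpha p1 p2).[z] / (Bden n alpha p1 p2).[z].

(* the rational function num/den equals a finite Blaschke product
   c * prod_j (z - a_j)/(1 - conj(a_j) z) with |c| = 1, |a_j| < 1,
   having d factors (equality of rational functions, cross-multiplied) *)
Definition blaschke_of (num den : {poly C}) (d : nat) : Prop :=
  den != 0 /\
  exists (c : C) (s : seq C),
    [/\ `|c| = 1, size s = d, all (fun a => `|a| < 1) s &
        num * \prod_(a <- s) (1 - a^* *: 'X) = c *: (den * \prod_(a <- s) ('X - a%:P))].

End RIF.

(* Main.v *)
Require Import Defs.
From HB Require Import structures.
From mathcomp Require Import all_boot all_order all_algebra.
From mathcomp Require Import complex.
From mathcomp Require Import reals.
From mathcomp Require Import ring.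
Set Implicit Arguments. Unset Strict Implicit. Unset Printing Implicit Defensive.
Import Order.TTheory GRing.Theory Num.Theory.
Local Open Scope ring_scope.

(* Write N/D for the uncancelled B_alpha, so that p~ - alpha p = z2 N - D and
   N is alpha times the reflection of D.  A one-variable f without zeros in the
   open disk is a product of factors g + b z with |b| <= |g|, and its reflection
   is the product of the b^* + g^* z.  Hence |refl f| <= |f| in the disk, and
   either equality at an interior point, or a contact of order two of refl f
   with u f at a point of the circle where f does not vanish, forces every
   |b| = |g|, so that refl f is a multiple of f.
   This is applied to f(z) = (1 - a^* z) p(z, zeta (z - a)/(1 - a^* z)), where
   |a| < 1 and |zeta| = 1, for which zeta refl f - alpha f =
   zeta (z - a) N - (1 - a^* z) D.  The interior case shows that D has no zero a
   in the disk, the boundary case (with a = 0) that its zeros on the circle are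
   simple.  The factors of D with |b| = |g| are, up to constants, common to N
   and D; the others give the Blaschke product.  Comparing two nontangential
   approaches to a zero (tau, lambda) of p shows that phi^* = alpha there if and
   only if D(tau) = 0. *)

(** * Linear factors and their reflections *)

Definition lin (K : numClosedFieldType) (x : K * K) : {poly K} :=
  x.2%:P + x.1 *: 'X.

(** This is the reflection of [lin x] in degree one. The case [x.1 = 0], a root at infinity, is
    allowed, so that a nonzero polynomial of degree below [m] still splits into [m] factors. *)
Definition rlin (K : numClosedFieldType) (x : K * K) : {poly K} :=
  x.1^*%:P + x.2^* *: 'X.

Definition outer (K : numClosedFieldType) (f : {poly K}) : Prop :=
  forall z, `|z| < 1 -> f.[z] != 0.

Lemma conjE_circle (K : numClosedFieldType) (z : K) : `|z| = 1 -> z^* = z^-1.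
Proof. by move=> z1; rewrite invC_norm z1 expr1n invr1 mul1r. Qed.

Lemma circle_neq0 (K : numClosedFieldType) (z : K) : `|z| = 1 -> z != 0.
Proof. by move=> z1; rewrite -normr_eq0 z1 oner_eq0. Qed.

Lemma horner_lin (K : numClosedFieldType) (x : K * K) z :
  (lin x).[z] = x.2 + x.1 * z.
Proof. by rewrite /lin !hornerE. Qed.

Lemma horner_rlin (K : numClosedFieldType) (x : K * K) z :
  (rlin x).[z] = x.1^* + x.2^* * z.
Proof. by rewrite /rlin !hornerE. Qed.

Lemma size_lin (K : numClosedFieldType) (x : K * K) : (size (lin x) <= 2)%N.
Proof.
rewrite /lin (leq_trans (size_polyD _ _)) // geq_max.
rewrite (leq_trans (size_polyC_leq1 _)) //=.
by rewrite (leq_trans (size_scale_leq _ _)) // size_polyX.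
Qed.

Lemma size_prod_lin (K : numClosedFieldType) (s : seq (K * K)) :
  (size (\prod_(x <- s) lin x)%R <= (size s).+1)%N.
Proof.
elim: s => [|x s IH]; first by rewrite big_nil size_poly1.
rewrite big_cons (leq_trans (size_polyMleq _ _)) //= -subn1 leq_subLR.
exact: leq_add (size_lin x) IH.
Qed.

(** All comparisons of [lin] with [rlin] rest on this identity: its sign gives the inequality inside
    the disk, its vanishing there the case of equality, and on the circle both moduli agree. *)
Lemma rlin_norm (K : numClosedFieldType) (x : K * K) z :
  `|(lin x).[z]| ^+ 2 - `|(rlin x).[z]| ^+ 2 =
  (`|x.2| ^+ 2 - `|x.1| ^+ 2) * (1 - `|z| ^+ 2).
Proof.
rewrite horner_lin horner_rlin !normCK !rmorphD !rmorphM /= !conjCK; ring.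
Qed.

Lemma lin_neq0 (K : numClosedFieldType) (x : K * K) z :
  `|x.1| <= `|x.2| -> x.2 != 0 -> `|z| < 1 -> (lin x).[z] != 0.
Proof.
move=> x12 x2 z1; rewrite horner_lin; apply/eqP => /eqP.
rewrite addr_eq0 => /eqP E.
have x2p : 0 < `|x.2| by rewrite normr_gt0.
have : `|x.2| < `|x.2|.
  rewrite {1}E normrN normrM; apply: le_lt_trans (_ : `|x.2| * `|z| < _).
    exact: ler_wpM2r.
  by rewrite -ltr_pdivlMl // mulVf ?gt_eqF.
by rewrite ltxx.
Qed.

Lemma rlin_le (K : numClosedFieldType) (x : K * K) z :
  `|x.1| <= `|x.2| -> `|z| < 1 -> `|(rlin x).[z]| <= `|(lin x).[z]|.
Proof.
move=> x12 z1; rewrite -ler_sqr ?nnegrE // -subr_ge0 rlin_norm.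
by rewrite mulr_ge0 ?subr_ge0 ?ler_sqr ?nnegrE // exprn_ile1 // ltW.
Qed.

Lemma rlin_eq (K : numClosedFieldType) (x : K * K) z :
  `|z| < 1 -> `|(rlin x).[z]| = `|(lin x).[z]| -> `|x.1| = `|x.2|.
Proof.
move=> z1 E; have /eqP := rlin_norm x z; rewrite E subrr eq_sym mulf_eq0.
rewrite !subr_eq0 => /orP[|] /eqP.
  by move/eqP; rewrite eqrXn2 // => /eqP.
by move=> E1; have := exprn_ilt1 2 (normr_ge0 z) z1; rewrite -E1 ltxx.
Qed.

Lemma rlin_unimod (K : numClosedFieldType) (x : K * K) :
  `|x.1| = `|x.2| -> x.2 != 0 -> rlin x = (x.2^* / x.1) *: lin x.
Proof.
move=> E x2; have x1 : x.1 != 0 by rewrite -normr_eq0 E normr_eq0.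
rewrite /rlin /lin scalerDr scalerA -mulrA mulVf // mulr1; congr (_ + _).
rewrite scale_polyC; congr (_%:P).
by apply: (mulfI x1); rewrite -normCK E normCK; field.
Qed.

Lemma prod_rlin_unimod (K : numClosedFieldType) (s : seq (K * K)) :
  all (fun x => (`|x.1| == `|x.2|) && (x.2 != 0)) s ->
  exists2 v, `|v| = 1 & \prod_(x <- s) rlin x = v *: \prod_(x <- s) lin x.
Proof.
elim: s => [_|x s IH] /=; first by exists 1; rewrite ?normr1 // !big_nil scale1r.
move=> /andP[/andP[/eqP x12 x2] /IH[v v1 E]].
exists (x.2^* / x.1 * v).
  by rewrite !normrM v1 mulr1 norm_conjC normfV x12 divff // normr_eq0.
by rewrite !big_cons E rlin_unimod // -scalerAl -scalerAr scalerA.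
Qed.

Lemma prod_rlin_le (K : numClosedFieldType) (s : seq (K * K)) z :
  all (fun x => (`|x.1| <= `|x.2|) && (x.2 != 0)) s -> `|z| < 1 ->
  `|\prod_(x <- s) (rlin x).[z]| <= `|\prod_(x <- s) (lin x).[z]|
  /\ 0 < `|\prod_(x <- s) (lin x).[z]|.
Proof.
move=> + z1; elim: s => [|x s IH] /=; first by rewrite !big_nil normr1 ltr01.
move=> /andP[/andP[x12 x2] /IH [le1 gt0]]; rewrite !big_cons !normrM; split.
  by rewrite ler_pM ?rlin_le.
by rewrite mulr_gt0 // normr_gt0 lin_neq0.
Qed.

(** Every factor satisfies [|rlin x| <= |lin x|] with a nonzero right side, so equality of the
    products forces equality factor by factor. *)
Lemma prod_rlin_eq (K : numClosedFieldType) (s : seq (K * K)) z :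
  all (fun x => (`|x.1| <= `|x.2|) && (x.2 != 0)) s -> `|z| < 1 ->
  `|\prod_(x <- s) (rlin x).[z]| = `|\prod_(x <- s) (lin x).[z]| ->
  all (fun x => (`|x.1| == `|x.2|) && (x.2 != 0)) s.
Proof.
move=> + z1; elim: s => [//|x s IH] /=.
move=> /andP[/andP[x12 x2] Hs]; rewrite !big_cons !normrM => E.
have [le1 gt0] := prod_rlin_le Hs z1.
have lx := rlin_le x12 z1.
have lx0 : 0 < `|(lin x).[z]| by rewrite normr_gt0 lin_neq0.
have E1 : `|(rlin x).[z]| = `|(lin x).[z]|.
  apply: le_anti; rewrite lx /=.
  rewrite -(ler_pM2r gt0) -E; exact: ler_wpM2l.
rewrite (rlin_eq z1 E1) eqxx x2 /=; apply: IH => //.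
by move: E; rewrite E1 => /mulfI; apply; rewrite gt_eqF.
Qed.

(** * Logarithmic derivatives and contact on the circle *)

Lemma logderiv_prod (F : fieldType) (I : Type) (s : seq I) (P : I -> {poly F}) z :
  all (fun x => (P x).[z] != 0) s ->
  (\prod_(x <- s) P x)^`().[z] =
  (\prod_(x <- s) P x).[z] * \sum_(x <- s) (P x)^`().[z] / (P x).[z].
Proof.
elim: s => [_|x s IH] /=; first by rewrite !big_nil derivC horner0 mulr0.
move=> /andP[x0 /IH E]; rewrite !big_cons derivM !hornerE E; field.
exact: x0.
Qed.

Lemma deriv_lin (K : numClosedFieldType) (x : K * K) : (lin x)^`() = x.1%:P.
Proof. by rewrite /lin derivD derivC derivZ derivX add0r alg_polyC. Qed.

Lemma deriv_rlin (K : numClosedFieldType) (x : K * K) : (rlin x)^`() = x.2^*%:P.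
Proof. by rewrite /rlin derivD derivC derivZ derivX add0r alg_polyC. Qed.

(** On the circle [z^* = 1/z], hence [rlin x] equals [z] times the conjugate of [lin x]. The right
    side is a Poisson-type kernel; its nonnegativity for [|b| <= |g|] is what the contact argument
    uses. *)
Lemma logderiv_rlin (K : numClosedFieldType) (x : K * K) z :
  `|z| = 1 -> (lin x).[z] != 0 ->
  z * ((rlin x)^`().[z] / (rlin x).[z] - (lin x)^`().[z] / (lin x).[z]) =
  (`|x.2| ^+ 2 - `|x.1| ^+ 2) / `|(lin x).[z]| ^+ 2.
Proof.
move=> z1; rewrite deriv_rlin deriv_lin !normCK !hornerC !horner_rlin !horner_lin.
rewrite !rmorphD !rmorphM /= (conjE_circle z1) => l0.
have z0 := circle_neq0 z1.
have : (x.2 + x.1 * z)^* != 0 by rewrite conjC_eq0.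
rewrite rmorphD rmorphM /= (conjE_circle z1) => r0.
have r1 : x.1^* + x.2^* * z != 0.
  have -> : x.1^* + x.2^* * z = z * (x.2^* + x.1^* / z) by field.
  by rewrite mulf_neq0.
field.
by rewrite l0 z0 andbT addrC.
Qed.

(** A double zero equates the values and the derivatives of the two products at [z], hence their
    logarithmic derivatives. The difference of the latter, times [z], is a sum of nonnegative terms,
    so each term vanishes. *)
Lemma prod_rlin_contact (K : numClosedFieldType) (s : seq (K * K)) u v z :
  all (fun x => (`|x.1| <= `|x.2|) && (x.2 != 0)) s -> `|z| = 1 ->
  (\prod_(x <- s) lin x).[z] != 0 ->
  ('X - z%:P) ^+ 2 %| (u *: \prod_(x <- s) rlin x - v *: \prod_(x <- s) lin x) ->
  v != 0 ->
  all (fun x => (`|x.1| == `|x.2|) && (x.2 != 0)) s.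
Proof.
move=> Hs z1 f0 /dvdpP[w E] v0.
have z0 := circle_neq0 z1.
have E0 : u * (\prod_(x <- s) rlin x).[z] = v * (\prod_(x <- s) lin x).[z].
  apply/eqP; rewrite -subr_eq0; apply/eqP.
  have := congr1 (horner^~ z) E; rewrite hornerM hornerD hornerN !hornerZ.
  by rewrite horner_exp hornerXsubC subrr expr0n mulr0.
have E1 : u * (\prod_(x <- s) rlin x)^`().[z] = v * (\prod_(x <- s) lin x)^`().[z].
  apply/eqP; rewrite -subr_eq0; apply/eqP.
  have := congr1 (fun q => (deriv q).[z]) E.
  rewrite /= derivB !derivZ expr2 !derivM hornerD hornerN !hornerZ => ->.
  by rewrite !(hornerXsubC, hornerM, hornerD) subrr; ring.
have Hl : all (fun x => (lin x).[z] != 0) s.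
  by move: f0; rewrite horner_prod prodf_seq_neq0.
have g0 : (\prod_(x <- s) rlin x).[z] != 0.
  by apply: contraTneq (mulf_neq0 v0 f0) => g0; rewrite -E0 g0 mulr0 eqxx.
have Hr : all (fun x => (rlin x).[z] != 0) s.
  by move: g0; rewrite horner_prod prodf_seq_neq0.
move: E1; rewrite !logderiv_prod // !mulrA E0 => /(mulfI (mulf_neq0 v0 f0)) /eqP.
rewrite -subr_eq0 -sumrB => /eqP /(congr1 (fun t => z * t)).
rewrite mulr0 mulr_sumr => /eqP.
under eq_big_seq => x xs do rewrite logderiv_rlin ?(allP Hl) //.
rewrite big_seq psumr_eq0 => [/allP H|x xs]; last first.
  have /andP[x12 _] := allP Hs _ xs.
  by rewrite mulr_ge0 ?invr_ge0 ?exprn_ge0 // subr_ge0 ler_sqr ?nnegrE.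
apply/allP => x xs; have /andP[_ ->] := allP Hs _ xs; rewrite andbT.
have := H _ xs; rewrite xs /= mulf_eq0 invr_eq0 expf_eq0 /= normr_eq0.
by rewrite (negPf (allP Hl _ xs)) orbF subr_eq0 eqrXn2 // eq_sym.
Qed.

(** * Factorization of outer polynomials and reflection *)

Lemma outer_factor (K : numClosedFieldType) (f : {poly K}) m :
  outer f -> (size f <= m.+1)%N ->
  exists c s, [/\ c != 0, size s = m,
    all (fun x => (`|x.1| <= `|x.2|) && (x.2 != 0)) s &
    f = c *: \prod_(x <- s) lin x].
Proof.
move=> Hf fm; have [r E] := closed_field_poly_normal f.
have f0 : f != 0.
  by apply: contraNneq (Hf 0 _) => [->|]; rewrite ?horner0 ?normr0 ?ltr01.
have c0 : lead_coef f != 0 by rewrite lead_coef_eq0.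
have sr : (size r <= m)%N.
  by move: fm; rewrite E size_scale // size_prod_XsubC ltnS.
(* A root [a] gives the factor [X - a], with [1 <= |a|] because [f] is outer. The pairs [(0, 1)]
   stand for the constant factor 1 and pad the list to length [m], the degree in which [f] is
   reflected. *)
exists (lead_coef f), ([seq (1, - a) | a <- r] ++ nseq (m - size r) (0, 1)).
split=> //; first by rewrite size_cat size_map size_nseq subnKC.
  rewrite all_cat all_nseq /= normr0 normr1 ler01 oner_neq0 orbT andbT all_map.
  apply/allP => a ar /=; rewrite normrN normr1 oppr_eq0.
  have fa : f.[a] = 0 by apply/rootP; rewrite E rootZ // root_prod_XsubC.
  rewrite real_leNgt ?normr_real ?real1 //.
  have a1 : ~~ (`|a| < 1) by apply/negP => /Hf; rewrite fa eqxx.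
  rewrite a1 /=; apply: contra a1 => /eqP ->; by rewrite normr0 ltr01.
have lin01 : lin (0 : K, 1 : K) = 1 by rewrite /lin /= scale0r addr0.
rewrite {1}E big_cat big_map big_nseq /= iter_fix ?lin01 ?mulr1 //.
by congr (_ *: _); apply: eq_bigr => a _; rewrite /lin /= scale1r addrC polyCN.
Qed.

Lemma coef_refl (R : realType) n (q : {poly R[i]}) i :
  (refl n q)`_i = if (i <= n)%N then (q`_(n - i))^* else 0.
Proof. by rewrite coef_poly ltnS. Qed.

Lemma size_refl (R : realType) n (q : {poly R[i]}) : (size (refl n q) <= n.+1)%N.
Proof. exact: size_poly. Qed.

Lemma reflD (R : realType) n (p q : {poly R[i]}) :
  refl n (p + q) = refl n p + refl n q.
Proof.
apply/polyP => i; rewrite coefD !coef_refl; case: ifP => _; last by rewrite addr0.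
by rewrite coefD rmorphD.
Qed.

Lemma reflZ (R : realType) n c (q : {poly R[i]}) :
  refl n (c *: q) = c^* *: refl n q.
Proof.
apply/polyP => i; rewrite coefZ !coef_refl; case: ifP => _; last by rewrite mulr0.
by rewrite coefZ rmorphM.
Qed.

Lemma reflK (R : realType) n (q : {poly R[i]}) :
  (size q <= n.+1)%N -> refl n (refl n q) = q.
Proof.
move=> qn; apply/polyP => i; rewrite !coef_refl leq_subr.
case: leqP => [le_in|lt_ni]; first by rewrite subKn // conjCK.
by rewrite nth_default // (leq_trans qn).
Qed.

(** Reflection is multiplicative when the reference degrees add up. The size bound removes the
    coefficient of [q] of index [n.+1], which appears at [i = 0]. *)
Lemma refl_lin (R : realType) n (x : R[i] * R[i]) (q : {poly R[i]}) :
  (size q <= n.+1)%N -> refl n.+1 (lin x * q) = rlin x * refl n q.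
Proof.
move=> qn; apply/polyP => i.
rewrite coef_refl /lin /rlin !mulrDl -!scalerAl !coefD !coefZ !coefCM !coefXM.
rewrite !coef_refl; case: i => [|i].
  rewrite subn0 /= mulr0 addr0 subn0 nth_default // mulr0 add0r rmorphM //.
rewrite ltnS subSS /= subn_eq0; case: (ltngtP i n) => [lt_in|lt_ni|->].
- by rewrite subnS rmorphD !rmorphM addrC.
- by rewrite !mulr0 addr0.
- by rewrite !mulr0 add0r addr0 rmorphM.
Qed.

Lemma refl_prod_lin (R : realType) (s : seq (R[i] * R[i])) :
  refl (size s) (\prod_(x <- s) lin x) = \prod_(x <- s) rlin x.
Proof.
elim: s => [|x s IH]; last by rewrite !big_cons refl_lin ?IH // size_prod_lin.
rewrite !big_nil; apply/polyP => i; rewrite coef_refl !coef1.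
by case: i => [|i] //=; rewrite conjC1.
Qed.

(** This connects the coefficientwise reflection with [z^n conj(q(1/conj z))], since [1/conj z = z]
    on the circle. *)
Lemma horner_refl (R : realType) n (q : {poly R[i]}) z :
  (size q <= n.+1)%N -> `|z| = 1 -> (refl n q).[z] = z ^+ n * (q.[z])^*.
Proof.
move=> qn z1; have z0 := circle_neq0 z1.
rewrite (horner_coef_wide _ (size_refl n q)) (horner_coef_wide _ qn).
rewrite rmorph_sum mulr_sumr (reindex_inj rev_ord_inj); apply: eq_bigr => i _ /=.
rewrite subSS coef_refl leq_subr subKn -1?ltnS // rmorphM rmorphXn /=.
rewrite (conjE_circle z1) mulrCA; congr (_ * _).
by rewrite exprVn expfB_cond // (negPf z0) leq_ord.
Qed.

Lemma outer_refl_contact (R : realType) n (f : {poly R[i]}) u v z :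
  outer f -> (size f <= n.+1)%N -> `|z| = 1 -> f.[z] != 0 -> v != 0 ->
  ('X - z%:P) ^+ 2 %| (u *: refl n f - v *: f) ->
  exists c, refl n f = c *: f.
Proof.
move=> fo fn z1 + v0; have [c [s [c0 ss Hs ->]]] := outer_factor fo fn.
rewrite reflZ -ss refl_prod_lin hornerZ mulf_eq0 negb_or => /andP[_ f0].
rewrite !scalerA => dv.
have /prod_rlin_unimod[w w0 E] := prod_rlin_contact Hs z1 f0 dv (mulf_neq0 v0 c0).
by exists (c^* * w / c); rewrite E !scalerA; congr (_ *: _); field.
Qed.

Lemma outer_refl_interior (R : realType) n (f : {poly R[i]}) z :
  outer f -> (size f <= n.+1)%N -> `|z| < 1 -> `|(refl n f).[z]| = `|f.[z]| ->
  exists c, refl n f = c *: f.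
Proof.
move=> fo fn z1; have [c [s [c0 ss Hs ->]]] := outer_factor fo fn.
rewrite reflZ -ss refl_prod_lin !hornerZ !normrM norm_conjC => /mulfI E.
have {}E : `|(\prod_(x <- s) rlin x).[z]| = `|(\prod_(x <- s) lin x).[z]|.
  by apply: E; rewrite normr_eq0.
rewrite !horner_prod in E.
have /prod_rlin_unimod[w w0 E'] := prod_rlin_eq Hs z1 E.
by exists (c^* * w / c); rewrite E' !scalerA; congr (_ *: _); field.
Qed.

(** * Non-tangential limits at the zeros of p *)

Lemma poly_lipschitz_disk (K : numClosedFieldType) (f : {poly K}) :
  exists2 M, 0 < M &
    forall z w, `|z| <= 1 -> `|w| <= 1 -> `|f.[z] - f.[w]| <= M * `|z - w|.
Proof.
elim/poly_ind: f => [|f c [M M0 HM]].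
  by exists 1 => // z w _ _; rewrite !horner0 subrr normr0 mul1r.
exists (M + (M + `|f.[0]|)) => [|z w z1 w1].
  by rewrite addr_gt0 // ltr_wpDr.
have fz : `|f.[z]| <= M + `|f.[0]|.
  have := HM z 0 z1; rewrite normr0 subr0 => /(_ ler01) fz0.
  rewrite -[f.[z]](subrK f.[0]) (le_trans (ler_normD _ _)) // lerD2r.
  by rewrite (le_trans fz0) // ler_piMr // ltW.
rewrite !hornerMXaddC opprD addrACA subrr addr0.
have -> : f.[z] * z - f.[w] * w = (f.[z] - f.[w]) * w + f.[z] * (z - w) by ring.
rewrite (le_trans (ler_normD _ _)) // !normrM mulrDl lerD //; last first.
  exact: ler_wpM2r.
by rewrite -[leRHS]mulr1 ler_pM // HM.
Qed.

Lemma normr_le_eps_eq0 (K : numClosedFieldType) (x M : K) :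
  0 < M -> (forall e, 0 < e -> e < 1 -> `|x| <= M * e) -> x = 0.
Proof.
move=> M0 H; apply/eqP; rewrite -normr_eq0; apply/negPn/negP => x0.
have xp : 0 < `|x| by rewrite lt_def x0 /=.
have sp : 0 < `|x| + M by rewrite addr_gt0.
(* This test value lies below 1 and turns the bound into [|x| + M <= M]. *)
have := H (`|x| / (`|x| + M)).
rewrite divr_gt0 // ltr_pdivrMr // mul1r ltrDl => /(_ isT M0).
rewrite mulrA ler_pdivlMr // mulrC ler_pM2r // gerDr => /le_lt_trans/(_ xp).
by rewrite ltxx.
Qed.

Lemma small_gt0 (K : numClosedFieldType) (x y : K) :
  0 < x -> 0 < y -> exists e, [/\ 0 < e, e <= x & e <= y].
Proof.
move=> x0 y0; have [xy|yx] := real_leP (gtr0_real x0) (gtr0_real y0).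
  by exists x; rewrite x0 lexx xy.
by exists y; rewrite y0 lexx (ltW yx).
Qed.

(** On the torus p~ is [z^n w] times the conjugate of p. *)
Lemma peval_refl_eq0 (R : realType) n (p1 p2 : {poly R[i]}) z w :
  (size p1 <= n.+1)%N -> (size p2 <= n.+1)%N -> `|z| = 1 -> `|w| = 1 ->
  peval p1 p2 z w = 0 -> peval (refl n p2) (refl n p1) z w = 0.
Proof.
move=> s1 s2 z1 w1; rewrite /peval !horner_refl // => /eqP.
rewrite addr_eq0 => /eqP ->; have w0 := circle_neq0 w1.
by rewrite rmorphN rmorphM /= (conjE_circle w1); field.
Qed.

(* On the two approach points (t(1-e), l(1-e)) and (t(1-e), l(1-2e)) the
   polynomial p is O(e), so p~ - L p is o(e) on both; the difference of its
   values there is l e (p~_1 - L p_2)(t(1-e)). *)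
Lemma ntlim_contact (R : realType) n (p1 p2 : {poly R[i]}) t l L :
  (forall z1 z2 : R[i], `|z1| < 1 -> `|z2| < 1 -> peval p1 p2 z1 z2 != 0) ->
  `|t| = 1 -> `|l| = 1 -> peval p1 p2 t l = 0 ->
  ntlim (phi n p1 p2) t l L -> (refl n p1).[t] = L * p2.[t].
Proof.
move=> pn0 t1 l1 p0 lim.
have [M1 M1p H1] := poly_lipschitz_disk p1.
have [M2 M2p H2] := poly_lipschitz_disk p2.
set h := refl n p1 - L *: p2.
have [M3 M3p H3] := poly_lipschitz_disk h.
suff : h.[t] = 0 by rewrite /h hornerD hornerN hornerZ => /subr0_eq.
(* [M * e] bounds p at both approach points: moving the first variable costs [M1 * e] and [M2 * e],
   and moving the second by at most [2 * e] costs the last term. *)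
set M := M1 + M2 + 2 * `|p2.[t]|.
have Mp : 0 < M by rewrite ltr_wpDr ?mulr_ge0 ?addr_gt0.
have Tp : 0 < 2 * M + M3 by rewrite addr_gt0 ?mulr_gt0.
apply: (normr_le_eps_eq0 Tp) => eta eta0 _.
(* Aperture 2 suffices: the approach is radial in each variable, where [|z - t| = 1 - |z|]. *)
have [d d0 Hd] := lim 2 eta (ltr1n _ 2) eta0.
(* The bounds by [d / 4] and [1 / 4] keep [2 * e] below [d] and [1 - 2 * e] positive; [e <= eta]
   later absorbs the Lipschitz error [M3 * e]. *)
have [e1 [e1p e1d e1h]] : exists e, [/\ 0 < e, e <= d / 4 & e <= (1/4 : R[i])].
  by apply: small_gt0; rewrite divr_gt0 ?ltr0n.
have [e [e0 ee1 eeta]] := small_gt0 e1p eta0.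
have ed : e * 2 < d.
  apply: le_lt_trans (_ : d / 2 < d); last first.
    by rewrite ltr_pdivrMr ?ltr0n // ltr_pMr ?ltr1n.
  rewrite (le_trans (ler_wpM2r _ (le_trans ee1 e1d))) ?ler0n //.
  by rewrite le_eqVlt; apply/orP; left; apply/eqP; field.
have e2 : e * 2 <= 1 / 2.
  rewrite (le_trans (ler_wpM2r _ (le_trans ee1 e1h))) ?ler0n //.
  by rewrite le_eqVlt; apply/orP; left; apply/eqP; field.
have e2lt : e * 2 < 1 by rewrite (le_lt_trans e2) // ltr_pdivrMr ?ltr0n // mul1r ltr1n.
have ele : e <= e * 2 by rewrite ler_peMr ?ler1n ?(ltW e0).
have pt (a k : R[i]) : `|a| = 1 -> 0 < k -> k <= e * 2 ->
    [/\ `|a * (1 - k)| = 1 - k, `|a * (1 - k)| < 1 & `|a * (1 - k) - a| = k].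
  move=> a1 k0 ke; have k1 : 0 < 1 - k by rewrite subr_gt0 (le_lt_trans ke).
  rewrite normrM a1 mul1r (gtr0_norm k1); split=> //; first by rewrite gtrBl.
  by rewrite mulrBr mulr1 addrAC subrr add0r normrN normrM a1 mul1r gtr0_norm.
have [zE z1 zd] := pt t e t1 e0 ele.
set z := t * (1 - e) in zE z1 zd.
have bound k : 0 < k -> k <= e * 2 ->
    `|peval (refl n p2) (refl n p1) z (l * (1 - k))
      - L * peval p1 p2 z (l * (1 - k))| <= eta * (M * e).
  move=> k0 ke; have [wE w1 wd] := pt l k l1 k0 ke.
  set w := l * (1 - k) in wE w1 wd *.
  have P0 := pn0 z w z1 w1.
  have : `|phi n p1 p2 z w - L| < eta.
    apply: Hd => //.
    - by rewrite zd zE opprB addrC subrK ltr_pMl ?ltr1n.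
    - by rewrite wd wE opprB addrC subrK ltr_pMl ?ltr1n.
    - by rewrite zd (le_lt_trans ele).
    - by rewrite wd (le_lt_trans ke).
  move=> Hphi.
  have -> : peval (refl n p2) (refl n p1) z w - L * peval p1 p2 z w
          = (phi n p1 p2 z w - L) * peval p1 p2 z w by rewrite /phi; field.
  rewrite normrM; apply: ler_pM => //; first exact: ltW.
  rewrite -[peval p1 p2 z w]subr0 -p0 /peval.
  have -> : p1.[z] + w * p2.[z] - (p1.[t] + l * p2.[t]) =
     (p1.[z] - p1.[t]) + w * (p2.[z] - p2.[t]) + (w - l) * p2.[t] by ring.
  rewrite (le_trans (ler_normD _ _)) // /M [leRHS]mulrDl lerD //; last first.
    by rewrite normrM wd mulrAC [2 * e]mulrC; apply: ler_wpM2r.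
  rewrite (le_trans (ler_normD _ _)) // mulrDl lerD //.
    by rewrite -zd H1 // ?t1 // ltW.
  rewrite normrM -[leRHS]mul1r; apply: ler_pM => //; first exact: ltW.
  by rewrite -zd H2 ?t1 // ltW.
have hz : `|h.[z]| <= 2 * M * eta.
  rewrite -(ler_pM2l e0).
  have := lerD (bound _ e0 ele) (bound _ (mulr_gt0 e0 (ltr0n _ 2)) (lexx _)).
  move=> /(le_trans (ler_normB _ _)); rewrite /peval.
  set X := (X in `|X|); have -> : X = l * e * h.[z].
    by rewrite /X /h hornerD hornerN hornerZ; ring.
  rewrite !normrM l1 mul1r (gtr0_norm e0) => /le_trans; apply.
  by rewrite le_eqVlt; apply/orP; left; apply/eqP; ring.
rewrite -[h.[t]](subrK h.[z]) (le_trans (ler_normD _ _)) // [leLHS]addrC mulrDl lerD //.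
by rewrite (le_trans (H3 _ _ _ _)) ?t1 // ?(ltW z1) // distrC zd ler_wpM2l // ltW.
Qed.

(** * Slices of p and the zeros of D *)

Lemma Bnum0_refl (R : realType) n (alpha : R[i]) (p1 p2 : {poly R[i]}) :
  (size p2 <= n.+1)%N -> `|alpha| = 1 ->
  Bnum0 n alpha p1 p2 = alpha *: refl n (Bden0 n alpha p1 p2).
Proof.
move=> s2 a1; rewrite /Bnum0 /Bden0 -[- refl n p2]scaleN1r reflD !reflZ reflK //.
rewrite scalerDr !scalerA rmorphN rmorph1 mulrN1 scaleNr.
by rewrite (conjE_circle a1) divff ?circle_neq0 // scale1r.
Qed.

(** The restriction of p to the graph of the disk automorphism [zeta (z - a) / (1 - a^* z)], cleared
    of its denominator. *)
Definition slice (K : numClosedFieldType) (a zeta : K) (p1 p2 : {poly K}) : {poly K} :=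
  (1 - a^* *: 'X) * p1 + (zeta *: ('X - a%:P)) * p2.

Lemma slice_linE (K : numClosedFieldType) (a zeta : K) (p1 p2 : {poly K}) :
  slice a zeta p1 p2 = lin (- a^*, 1) * p1 + zeta *: (lin (1, - a) * p2).
Proof.
by rewrite /slice /lin /= scaleNr scale1r polyCN -scalerAl ['X - _]addrC.
Qed.

Lemma size_slice (K : numClosedFieldType) (a zeta : K) (p1 p2 : {poly K}) n :
  (size p1 <= n.+1)%N -> (size p2 <= n.+1)%N ->
  (size (slice a zeta p1 p2) <= n.+2)%N.
Proof.
move=> s1 s2; rewrite slice_linE (leq_trans (size_polyD _ _)) // geq_max.
have H x (q : {poly K}) : (size q <= n.+1)%N -> (size (lin x * q)%R <= n.+2)%N.
  move=> sq; rewrite (leq_trans (size_polyMleq _ _)) // -subn1 leq_subLR.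
  exact: leq_add (size_lin x) sq.
by rewrite H //= (leq_trans (size_scale_leq _ _)) // H.
Qed.

(** The automorphism maps the disk into itself, so the graph stays in the bidisk. Its modulus is
    bounded through [rlin_norm], as [z - a] is the reflection of [1 - a^* z]. *)
Lemma outer_slice (R : realType) (a zeta : R[i]) (p1 p2 : {poly R[i]}) :
  (forall z1 z2 : R[i], `|z1| < 1 -> `|z2| < 1 -> peval p1 p2 z1 z2 != 0) ->
  `|a| < 1 -> `|zeta| = 1 -> outer (slice a zeta p1 p2).
Proof.
move=> pn0 a1 zeta1 z z1.
have d0 : (lin (- a^*, 1)).[z] != 0.
  by apply: lin_neq0; rewrite ?oner_neq0 //= normrN norm_conjC normr1 ltW.
set w := zeta * (z - a) / (lin (- a^*, 1)).[z].
have w1 : `|w| < 1.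
  rewrite !normrM zeta1 mul1r normfV ltr_pdivrMr ?normr_gt0 // mul1r.
  rewrite -ltr_sqr ?nnegrE // -subr_gt0.
  have := rlin_norm (- a^*, 1) z.
  rewrite horner_rlin /= rmorphN /= conjCK conjC1 mul1r [- a + z]addrC => ->.
  rewrite normrN norm_conjC normr1 expr1n.
  by rewrite mulr_gt0 // subr_gt0 exprn_ilt1.
have -> : (slice a zeta p1 p2).[z] = (lin (- a^*, 1)).[z] * peval p1 p2 z w.
  rewrite slice_linE hornerD hornerZ !hornerM /peval /w [(lin (1, _)).[z]]horner_lin /=.
  by field.
by rewrite mulf_neq0 // pn0.
Qed.

Lemma refl_slice (R : realType) n (alpha a zeta : R[i]) (p1 p2 : {poly R[i]}) :
  (size p1 <= n.+1)%N -> (size p2 <= n.+1)%N -> `|zeta| = 1 ->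
  zeta *: refl n.+1 (slice a zeta p1 p2) - alpha *: slice a zeta p1 p2 =
  zeta *: (('X - a%:P) * Bnum0 n alpha p1 p2)
  - (1 - a^* *: 'X) * Bden0 n alpha p1 p2.
Proof.
move=> s1 s2 z1; rewrite slice_linE reflD reflZ !refl_lin // scalerDr scalerA.
rewrite (conjE_circle z1) divff ?circle_neq0 // scale1r /lin /rlin /Bnum0 /Bden0 /=.
rewrite !rmorphN /= conjCK !conjC1 -!mul_polyC !polyCN; ring.
Qed.

(** If the reflection of the slice [f] is [c f], the left side of [refl_slice] is
    [(zeta c - alpha) f]. Its right side vanishes at [z] while [f] does not, so the constant is zero
    and the right side vanishes identically. *)
Lemma slice_rigid (R : realType) n (alpha a zeta z : R[i]) (p1 p2 : {poly R[i]}) :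
  (size p1 <= n.+1)%N -> (size p2 <= n.+1)%N -> `|zeta| = 1 ->
  (Bnum0 n alpha p1 p2).[z] = 0 \/ z = a -> (Bden0 n alpha p1 p2).[z] = 0 ->
  (slice a zeta p1 p2).[z] != 0 ->
  (exists c, refl n.+1 (slice a zeta p1 p2) = c *: slice a zeta p1 p2) ->
  zeta *: (('X - a%:P) * Bnum0 n alpha p1 p2) =
  (1 - a^* *: 'X) * Bden0 n alpha p1 p2.
Proof.
move=> s1 s2 z1 N0 D0 f0 [c E]; have H := refl_slice alpha a s1 s2 z1.
apply/eqP; rewrite -subr_eq0 -H E scalerA -scalerBl.
have : (zeta * c - alpha) * (slice a zeta p1 p2).[z] = 0.
  rewrite -hornerZ scalerBl -scalerA -E H hornerD hornerN hornerZ !hornerM D0.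
  rewrite mulr0 subr0 hornerXsubC; case: N0 => ->; first by rewrite !mulr0.
  by rewrite subrr mul0r mulr0.
by move/eqP; rewrite mulf_eq0 (negPf f0) orbF => /eqP ->; rewrite scale0r.
Qed.

(** Otherwise p~ = alpha p, so p itself is a common factor and hence constant; then [p2 = 0] and
    [refl n p1 = alpha *: p2] vanishes. *)
Lemma no_common_factor_neq (R : realType) n (alpha : R[i]) (p1 p2 : {poly R[i]}) :
  refl n p1 != 0 ->
  no_common_factor (bipoly p1 p2) (bipoly (refl n p2) (refl n p1)) ->
  ~ (Bnum0 n alpha p1 p2 = 0 /\ Bden0 n alpha p1 p2 = 0).
Proof.
move=> q1 ncf [/subr0_eq N0 /subr0_eq D0].
have [||c E] := ncf (bipoly p1 p2) 1 alpha%:P%:P.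
- by rewrite mulr1.
- rewrite N0 -D0 /bipoly -!mul_polyC !polyCM; ring.
have := congr1 (fun q : {poly {poly R[i]}} => q`_1) E.
rewrite /bipoly coefD !coefC /= coefXM /= coefC add0r => p20.
by move: q1; rewrite N0 p20 scaler0 eqxx.
Qed.

Lemma p1_neq0_disk (R : realType) (p1 p2 : {poly R[i]}) z :
  (forall z1 z2 : R[i], `|z1| < 1 -> `|z2| < 1 -> peval p1 p2 z1 z2 != 0) ->
  `|z| < 1 -> p1.[z] != 0.
Proof.
move=> pn0 z1; have := pn0 z 0 z1; rewrite /peval mul0r addr0; apply.
by rewrite normr0 ltr01.
Qed.

(** In the disk [|p2| <= |p1|], since otherwise [- p1 / p2] gives a zero of p in the bidisk. By
    continuity a zero [t] of [p1] is one of [p2], and [X - t] then divides both p and p~. *)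
Lemma p1_neq0_circle (R : realType) n (p1 p2 : {poly R[i]}) t :
  (forall z1 z2 : R[i], `|z1| < 1 -> `|z2| < 1 -> peval p1 p2 z1 z2 != 0) ->
  (size p1 <= n.+1)%N -> (size p2 <= n.+1)%N ->
  no_common_factor (bipoly p1 p2) (bipoly (refl n p2) (refl n p1)) ->
  `|t| = 1 -> p1.[t] != 0.
Proof.
move=> pn0 s1 s2 ncf t1; apply/eqP => p10.
have le21 z : `|z| < 1 -> `|p2.[z]| <= `|p1.[z]|.
  move=> z1; rewrite real_leNgt ?normr_real //; apply/negP => lt12.
  have p2p : 0 < `|p2.[z]| by apply: le_lt_trans lt12.
  have p20 : p2.[z] != 0 by rewrite -normr_gt0.
  have /(pn0 _ _ z1) : `|- p1.[z] / p2.[z]| < 1.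
    by rewrite mulNr normrN normrM normfV ltr_pdivrMr // mul1r.
  by rewrite /peval divfK // subrr eqxx.
have [M1 M1p H1] := poly_lipschitz_disk p1.
have [M2 M2p H2] := poly_lipschitz_disk p2.
have p20 : p2.[t] = 0.
  apply: (normr_le_eps_eq0 (addr_gt0 M1p M2p)) => e e0 e1.
  have e1' : 0 < 1 - e by rewrite subr_gt0.
  have zE : `|t * (1 - e)| < 1 by rewrite normrM t1 mul1r gtr0_norm // gtrBl.
  have zd : `|t * (1 - e) - t| = e.
    by rewrite mulrBr mulr1 addrAC subrr add0r normrN normrM t1 mul1r gtr0_norm.
  set z := t * (1 - e) in zE zd.
  rewrite -[p2.[t]](subrK p2.[z]) (le_trans (ler_normD _ _)) //.
  rewrite [leLHS]addrC mulrDl lerD //.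
    rewrite (le_trans (le21 _ zE)) // -[p1.[z]]subr0 -p10 -zd.
    by rewrite H1 // ?t1 // ltW.
  by rewrite -zd [in leRHS]distrC H2 // ?t1 // ltW.
have fac (q1 q2 : {poly R[i]}) : q1.[t] = 0 -> q2.[t] = 0 ->
    exists r, bipoly q1 q2 = ('X - t%:P)%:P * r.
  move=> /rootP /factor_theorem[r1 E1] /rootP /factor_theorem[r2 E2].
  exists (bipoly r1 r2); rewrite /bipoly E1 E2 !polyCM; ring.
have [r Er] := fac _ _ p10 p20.
have [||r' Er'] := fac (refl n p2) (refl n p1).
- by rewrite horner_refl // p20 conjC0 mulr0.
- by rewrite horner_refl // p10 conjC0 mulr0.
have [c /polyC_inj Ec] := ncf _ _ _ Er Er'.
have := congr1 (fun q : {poly _} => size q) Ec; rewrite size_XsubC size_polyC.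
by case: (c != 0).
Qed.

(** At a zero [a] of D one has p~_2 = alpha p_1, so the slice through [(a, 0)] and its reflection
    have equal modulus at [a]. The interior case of rigidity then applies for every unimodular
    [zeta]. *)
Lemma outer_Bden0 (R : realType) n (alpha : R[i]) (p1 p2 : {poly R[i]}) :
  (forall z1 z2 : R[i], `|z1| < 1 -> `|z2| < 1 -> peval p1 p2 z1 z2 != 0) ->
  (size p1 <= n.+1)%N -> (size p2 <= n.+1)%N -> `|alpha| = 1 ->
  refl n p1 != 0 ->
  no_common_factor (bipoly p1 p2) (bipoly (refl n p2) (refl n p1)) ->
  outer (Bden0 n alpha p1 p2).
Proof.
move=> pn0 s1 s2 al1 q1 ncf a a1; apply/eqP => D0.
have q2E : (refl n p2).[a] = alpha * p1.[a].
  by move: D0; rewrite hornerD hornerN hornerZ => /subr0_eq.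
have p1a := p1_neq0_disk pn0 a1.
have aa : 1 - a^* * a != 0.
  by rewrite mulrC -normCK subr_eq0 eq_sym lt_eqF // exprn_ilt1.
have sl zeta : (slice a zeta p1 p2).[a] = (1 - a^* * a) * p1.[a].
  rewrite slice_linE hornerD hornerZ !hornerM !horner_lin /=; ring.
have key zeta : `|zeta| = 1 ->
    zeta *: (('X - a%:P) * Bnum0 n alpha p1 p2) =
    (1 - a^* *: 'X) * Bden0 n alpha p1 p2.
  move=> z1; apply: (@slice_rigid _ n alpha a zeta a) => //; first by right.
    by rewrite sl mulf_neq0.
  apply: (outer_refl_interior (z := a)) => //.
  - exact: outer_slice.
  - exact: size_slice.
  rewrite sl slice_linE reflD reflZ !refl_lin // hornerD hornerZ !hornerM.
  rewrite !horner_rlin /= q2E rmorphN /= conjCK conjC1 mul1r addNr mul0r add0r.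
  by rewrite rmorphN mulNr !normrM norm_conjC z1 al1 !mul1r.
(* Replacing [zeta = 1] by [-1] changes the sign of the left side only, so both sides vanish and N =
   D = 0. *)
have K1 := key 1 (normr1 _); have K2 := key (-1) (etrans (normrN _) (normr1 _)).
have E0 : (1 - a^* *: 'X) * Bden0 n alpha p1 p2 = 0.
  have : 2 *: ((1 - a^* *: 'X) * Bden0 n alpha p1 p2) = 0.
    by rewrite scaler_nat mulr2n -{1}K1 -K2 scale1r scaleN1r subrr.
  by move/eqP; rewrite scaler_eq0 pnatr_eq0 => /eqP.
have aX : 1 - a^* *: 'X != 0 :> {poly R[i]}.
  apply/negP => /eqP /(congr1 (horner^~ a)).
  by rewrite !hornerE; apply/eqP.
apply: (no_common_factor_neq (alpha := alpha) q1 ncf); split.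
  move: K1; rewrite E0 scale1r => /eqP; rewrite mulf_eq0 polyXsubC_eq0 /=.
  by move/eqP.
by move/eqP: E0; rewrite mulf_eq0 (negPf aX) => /eqP.
Qed.

Lemma Bden0_simple_zero (R : realType) n (alpha t : R[i]) (p1 p2 : {poly R[i]}) :
  (forall z1 z2 : R[i], `|z1| < 1 -> `|z2| < 1 -> peval p1 p2 z1 z2 != 0) ->
  (size p1 <= n.+1)%N -> (size p2 <= n.+1)%N -> `|alpha| = 1 ->
  outer (Bden0 n alpha p1 p2) -> `|t| = 1 -> p1.[t] != 0 ->
  ('X - t%:P) ^+ 2 %| Bden0 n alpha p1 p2 ->
  ('X - t%:P) ^+ 2 %| Bnum0 n alpha p1 p2 -> False.
Proof.
move=> pn0 s1 s2 al1 Dout t1 p1t dD dN.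
have t0 := circle_neq0 t1.
have zero (q : {poly R[i]}) : ('X - t%:P) ^+ 2 %| q -> q.[t] = 0.
  by case/dvdpP => w ->; rewrite hornerM horner_exp hornerXsubC subrr expr0n mulr0.
have D0 := zero _ dD; have N0 := zero _ dN.
have p12 : `|p2.[t]| = `|p1.[t]|.
  move: D0; rewrite hornerD hornerN hornerZ horner_refl // => /subr0_eq.
  move/(congr1 (fun x => `|x|)); rewrite !normrM normrX al1 t1 expr1n !mul1r.
  by rewrite norm_conjC.
have p2t : p2.[t] != 0 by rewrite -normr_eq0 p12 normr_eq0.
(* This [zeta] makes the two terms of the slice equal at [t], so that they add up to [2 * p1.[t]]
   instead of cancelling. *)
set zeta := p1.[t] / (t * p2.[t]).
have zeta1 : `|zeta| = 1.
  by rewrite normrM normfV normrM t1 mul1r p12 divff // normr_eq0.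
have sl : (slice 0 zeta p1 p2).[t] = 2 * p1.[t].
  rewrite slice_linE hornerD hornerZ !hornerM !horner_lin /= conjC0 /zeta; field.
  by rewrite p2t t0.
have sl0 : (slice 0 zeta p1 p2).[t] != 0 by rewrite sl mulf_neq0 ?pnatr_eq0.
have E : zeta *: (('X - 0%:P) * Bnum0 n alpha p1 p2) =
    (1 - 0^* *: 'X) * Bden0 n alpha p1 p2.
  apply: (@slice_rigid _ n alpha 0 zeta t) => //; first by left.
  apply: (@outer_refl_contact _ _ _ zeta alpha t) => //.
  - by apply: outer_slice; rewrite ?normr0 ?ltr01.
  - exact: size_slice.
  - exact: circle_neq0.
  by rewrite refl_slice // dvdp_sub // ?dvdpZr ?circle_neq0 ?dvdp_mull.
(* The identity [zeta z N = D] makes D vanish at the origin. *)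
have := Dout 0; rewrite normr0 ltr01 => /(_ isT) /eqP; apply.
have := congr1 (horner^~ 0) E; rewrite hornerZ !hornerM hornerXsubC subrr mul0r mulr0.
by rewrite hornerD hornerN hornerZ hornerX mulr0 subr0 hornerC mul1r.
Qed.

(** * Blaschke factors and the cancelled quotient *)

Lemma lin_blaschke (K : numClosedFieldType) (x : K * K) :
  x.2 != 0 -> lin x = x.2 *: (1 - (- (x.1 / x.2)^*)^* *: 'X).
Proof.
move=> x2; rewrite rmorphN /= conjCK scaleNr opprK scalerDr scalerA mulrCA divff //.
by rewrite mulr1 /lin alg_polyC.
Qed.

Lemma rlin_blaschke (K : numClosedFieldType) (x : K * K) :
  x.2 != 0 -> rlin x = x.2^* *: ('X - (- (x.1 / x.2)^*)%:P).
Proof.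
move=> x2; have -> : (x.1 / x.2)^* = x.1^* / x.2^* by rewrite rmorphM /= fmorphV.
rewrite polyCN opprK scalerDr scale_polyC mulrCA divff ?conjC_eq0 //.
by rewrite mulr1 /rlin addrC.
Qed.

Lemma blaschke_of_lin (R : realType) (num den : {poly R[i]}) c1 c2
    (s : seq (R[i] * R[i])) :
  den != 0 -> `|c1| = `|c2| -> c1 != 0 ->
  all (fun x => `|x.1| < `|x.2|) s ->
  c1 *: (num * \prod_(x <- s) lin x) = c2 *: (den * \prod_(x <- s) rlin x) ->
  blaschke_of num den (size s).
Proof.
move=> den0 c12 c10 Hs E; split=> //.
(* [b x] is the zero of [rlin x]. Reflection conjugates the constants pulled out of the factors, so
   the total constant [k^* / k] is unimodular. *)
pose b (x : R[i] * R[i]) := - (x.1 / x.2)^*.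
have [k k0 [El Er]] : exists2 k, k != 0 &
    \prod_(x <- s) lin x = k *: \prod_(a <- map b s) (1 - a^* *: 'X) /\
    \prod_(x <- s) rlin x = k^* *: \prod_(a <- map b s) ('X - a%:P).
  elim: s Hs {E} => [_|x s IH] /=.
    by exists 1; rewrite ?oner_neq0 // !big_nil conjC1 !scale1r.
  move=> /andP[x12 /IH[k k0 [El Er]]].
  have x2 : x.2 != 0 by rewrite -normr_gt0 (le_lt_trans _ x12).
  exists (x.2 * k); first by rewrite mulf_neq0.
  rewrite !big_cons El Er rmorphM /= lin_blaschke // rlin_blaschke //.
  by rewrite -!scalerAl -!scalerAr !scalerA.
have c0 : c1 * k != 0 by rewrite mulf_neq0.
exists (c2 * k^* / (c1 * k)), (map b s); split.
- by rewrite !normrM normfV normrM norm_conjC c12 divff // -c12 -normrM normr_eq0.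
- by rewrite size_map.
- rewrite all_map; apply/allP => x xs /=; rewrite /b normrN norm_conjC normrM normfV.
  have x12 := allP Hs _ xs; have x2 : 0 < `|x.2| by rewrite (le_lt_trans _ x12).
  by rewrite ltr_pdivrMr // mul1r.
apply: (scalerI c0); rewrite scalerA mulrCA divff // mulr1.
by move: E; rewrite El Er -!scalerAr !scalerA.
Qed.

(** Blaschke factors are unimodular on the circle, so numerator and denominator have equal modulus
    there, and coprimality excludes a common zero. Hence [Bval] is a true quotient on the circle,
    never a division by zero. *)
Lemma blaschke_circle (R : realType) (num den : {poly R[i]}) d z :
  blaschke_of num den d -> coprimep num den -> `|z| = 1 ->
  den.[z] != 0 /\ `|num.[z]| = `|den.[z]|.
Proof.
move=> [den0 [c [s [c1 _ Hs E]]]] cop z1.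
have nz a : a \in s -> 'X.[z] - a != 0.
  move=> as_; rewrite hornerX subr_eq0; apply: contraTneq (allP Hs _ as_) => <-.
  by rewrite z1 ltxx.
have P0 : \prod_(a <- s) ('X - a%:P).[z] != 0.
  rewrite prodf_seq_neq0; apply/allP => a as_ /=.
  by rewrite hornerXsubC -{1}[z]hornerX nz.
have PE : `|\prod_(a <- s) (1 - a^* *: 'X).[z]| = `|\prod_(a <- s) ('X - a%:P).[z]|.
  rewrite !normr_prod; apply: eq_bigr => a _; apply/eqP.
  rewrite -(@eqrXn2 _ 2) // -subr_eq0.
  have := rlin_norm (- a^*, 1) z; rewrite z1 expr1n subrr mulr0 => /eqP.
  rewrite /lin /rlin /= rmorphN /= conjCK conjC1.
  by rewrite scale1r scaleNr polyCN [_ + 'X]addrC.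
have /(congr1 (horner^~ z)) := E; rewrite hornerZ !hornerM !horner_prod => {}E.
have NE : `|num.[z]| = `|den.[z]|.
  have /(congr1 (fun x => `|x|)) := E; rewrite !normrM PE c1 mul1r.
  by apply: mulIf; rewrite normr_eq0.
split=> //; apply/negP => /eqP d0.
have n0 : num.[z] = 0 by apply/eqP; rewrite -normr_eq0 NE d0 normr0.
by have := coprimep_root cop (introT rootP n0); rewrite d0 eqxx.
Qed.

Lemma not_uniq_dvdp_sqr (F : fieldType) (rs : seq F) :
  ~~ uniq rs ->
  exists2 t, t \in rs & ('X - t%:P) ^+ 2 %| \prod_(a <- rs) ('X - a%:P).
Proof.
elim: rs => [//|r rs IH] /=; rewrite negb_and negbK => /orP[r_rs|/IH[t t_rs d]].
  exists r; first exact: mem_head.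
  by rewrite big_cons expr2 dvdp_mul // dvdp_XsubCl root_prod_XsubC.
by exists t; rewrite ?inE ?t_rs ?orbT // big_cons dvdp_mull.
Qed.

Lemma prod_lin_roots (K : numClosedFieldType) (s : seq (K * K)) :
  all (fun x => x.1 != 0) s ->
  exists2 k, k != 0 &
    \prod_(x <- s) lin x = k *: \prod_(a <- [seq - x.2 / x.1 | x <- s]) ('X - a%:P).
Proof.
elim: s => [_|x s IH] /=.
  by exists 1; rewrite ?oner_neq0 // !big_nil scale1r.
move=> /andP[x1 /IH[k k0 E]]; exists (x.1 * k); first by rewrite mulf_neq0.
have xE : lin x = x.1 *: ('X - (- x.2 / x.1)%:P).
  by rewrite mulNr polyCN opprK scalerDr scale_polyC mulrCA divff // mulr1 /lin addrC.
by rewrite !big_cons E {1}xE -scalerAl -scalerAr scalerA.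
Qed.

Lemma blaschke_Bnum (R : realType) n (alpha : R[i]) (p1 p2 : {poly R[i]}) :
  let N := Bnum0 n alpha p1 p2 in let D := Bden0 n alpha p1 p2 in
  (size p1 <= n.+1)%N -> (size p2 <= n.+1)%N -> `|alpha| = 1 -> outer D ->
  exists rt : seq R[i],
  [/\ blaschke_of (Bnum n alpha p1 p2) (Bden n alpha p1 p2) (n - size rt),
      forall t, t \in rt <-> `|t| = 1 /\ D.[t] = 0 &
      ~~ uniq rt -> exists t, [/\ `|t| = 1, ('X - t%:P) ^+ 2 %| D &
                                 ('X - t%:P) ^+ 2 %| N]].
Proof.
move=> N D s1 s2 al1 Dout.
have sD : (size D <= n.+1)%N.
  rewrite (leq_trans (size_polyD _ _)) // geq_max size_polyN size_refl andbT.
  by rewrite (leq_trans (size_scale_leq _ _)).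
have NE : N = alpha *: refl n D by rewrite /N /D -Bnum0_refl.
have [c [s [c0 ss Hs DE]]] := outer_factor Dout sD.
pose P (x : R[i] * R[i]) := `|x.1| == `|x.2|.
pose sT := filter P s; pose sI := filter (predC P) s.
have perm_s : perm_eq s (sT ++ sI) by rewrite perm_sym perm_filterC.
have HT : all (fun x => (`|x.1| == `|x.2|) && (x.2 != 0)) sT.
  apply/allP => x; rewrite mem_filter => /andP[Px xs]; rewrite -/(P x) Px /=.
  by have /andP[] := allP Hs _ xs.
have HI : all (fun x => `|x.1| < `|x.2|) sI.
  apply/allP => x; rewrite mem_filter => /andP[/= Px xs].
  by have /andP[x12 _] := allP Hs _ xs; rewrite lt_neqAle Px.
have [v v1 vE] := prod_rlin_unimod HT.
pose G := \prod_(x <- sT) lin x.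
have {}NE : N = (alpha * c^* * v) *: (G * \prod_(x <- sI) rlin x).
  rewrite NE DE reflZ -ss refl_prod_lin (perm_big _ perm_s) big_cat /= vE.
  by rewrite -scalerAl !scalerA.
have {}DE : D = c *: (G * \prod_(x <- sI) lin x).
  by rewrite DE (perm_big _ perm_s) big_cat.
have D0 : D != 0.
  by apply: contraNneq (Dout 0 _) => [->|]; rewrite ?horner0 ?normr0 ?ltr01.
have G0 : G != 0 by apply: contraNneq D0 => G0; rewrite DE G0 mul0r scaler0.
have HT1 : all (fun x => x.1 != 0) sT.
  apply: sub_all HT => x /andP[/eqP x12 x2].
  by rewrite -normr_eq0 x12 normr_eq0.
pose rt := [seq - x.2 / x.1 | x <- sT].
have [k k0 GE] : exists2 k, k != 0 & G = k *: \prod_(a <- rt) ('X - a%:P).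
  exact: prod_lin_roots.
have sI_size : size sI = (n - size rt)%N.
  by rewrite -ss (perm_size perm_s) size_cat size_map addKn.
have rt_circle t : t \in rt -> `|t| = 1.
  move=> /mapP[x xT ->]; have /andP[/eqP x12 x2] := allP HT _ xT.
  by rewrite mulNr normrN normrM normfV x12 divff // normr_eq0.
have root_rt t : t \in rt -> G.[t] = 0.
  by move=> t_rt; apply/rootP; rewrite GE rootZ // root_prod_XsubC.
exists rt; split.
- rewrite -sI_size; set g := gcdp N D.
  have g0 : g != 0 by rewrite gcdp_eq0 negb_and D0 orbT.
  have NB : Bnum n alpha p1 p2 * g = N by rewrite divpK // dvdp_gcdl.
  have DB : Bden n alpha p1 p2 * g = D by rewrite divpK // dvdp_gcdr.
  apply: (@blaschke_of_lin _ _ _ c (alpha * c^* * v)) => //.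
  + by apply: contraNneq D0 => B0; rewrite -DB B0 mul0r.
  + by rewrite !normrM v1 al1 norm_conjC mul1r mulr1.
  (* The gcd [g] need not be identified with [G]: after multiplication by [g * G] both sides equal
     [N * D]. *)
  apply: (mulIf (mulf_neq0 g0 G0)).
  have -> : c *: (Bnum n alpha p1 p2 * \prod_(x <- sI) lin x) * (g * G) = N * D.
    by rewrite -NB DE -!scalerAl -!scalerAr; congr (_ *: _); ring.
  have -> : (alpha * c^* * v) *: (Bden n alpha p1 p2 * \prod_(x <- sI) rlin x) * (g * G)
     = N * (Bden n alpha p1 p2 * g).
    by rewrite NE -!scalerAl; congr (_ *: _); ring.
  by rewrite DB.
- move=> t; split=> [t_rt|[t1]].
    by split; [exact: rt_circle|rewrite DE hornerZ hornerM root_rt // mul0r mulr0].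
  move/eqP; rewrite DE hornerZ !hornerM !mulf_eq0 (negPf c0) /= => /orP[].
    by rewrite GE hornerZ mulf_eq0 (negPf k0) /= -[_ == 0]/(root _ t) root_prod_XsubC.
  rewrite horner_prod => /eqP/eqP; apply: contraTT => _.
  rewrite prodf_seq_neq0; apply/allP => x xI /=; rewrite horner_lin addr_eq0.
  apply: contraTneq (allP HI _ xI) => ->.
  by rewrite normrN normrM t1 mulr1 ltxx.
move=> /not_uniq_dvdp_sqr[t t_rt d]; exists t; split; first exact: rt_circle.
  by rewrite DE dvdpZr // dvdp_mulr // GE dvdpZr.
have w0 : alpha * c^* * v != 0.
  by rewrite -normr_eq0 !normrM v1 al1 norm_conjC mul1r mulr1 normr_eq0.
by rewrite NE dvdpZr // dvdp_mulr // GE dvdpZr.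
Qed.

(** * Matching zeros of p with zeros of D, and the level set *)

Lemma simple_zeros_perm (R : realType) n (alpha : R[i]) (p1 p2 : {poly R[i]})
    (zs ys : seq (R[i] * R[i])) (rt : seq R[i]) :
  (forall z1 z2 : R[i], `|z1| < 1 -> `|z2| < 1 -> peval p1 p2 z1 z2 != 0) ->
  (size p1 <= n.+1)%N -> (size p2 <= n.+1)%N -> `|alpha| = 1 ->
  (forall t, `|t| = 1 -> p1.[t] != 0) ->
  (forall w, w \in zs <->
     [/\ `|w.1| = 1, `|w.2| = 1 & peval p1 p2 w.1 w.2 = 0]) ->
  (forall w1 w2 : R[i], `|w1| = 1 -> `|w2| = 1 ->
     exists L : R[i], `|L| = 1 /\ ntlim (phi n p1 p2) w1 w2 L) ->
  (forall w, w \in ys <-> w \in zs /\ ntlim (phi n p1 p2) w.1 w.2 alpha) ->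
  (forall t, t \in rt <-> `|t| = 1 /\ (Bden0 n alpha p1 p2).[t] = 0) ->
  uniq ys -> uniq rt -> perm_eq (map fst ys) rt.
Proof.
move=> pn0 s1 s2 al1 p1n0 Hzs Hlim Hys Hrt uys urt.
(* At a zero [(t, l)] of p, p_1 = - l p_2 and p~_2 = - l p~_1, so p~_1 = L p_2 becomes p~_2 = L p_1.
   As [p1.[t]] is nonzero, [L = alpha] exactly when D vanishes at [t]. *)
have lim_eq t l L : `|t| = 1 -> `|l| = 1 -> peval p1 p2 t l = 0 ->
    ntlim (phi n p1 p2) t l L -> (refl n p2).[t] = L * p1.[t].
  move=> t1 l1 p0 /(ntlim_contact pn0 t1 l1 p0) E.
  have := peval_refl_eq0 s1 s2 t1 l1 p0; rewrite /peval E => /eqP.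
  rewrite addr_eq0 => /eqP ->; move/eqP: p0; rewrite addr_eq0 => /eqP ->; ring.
apply: uniq_perm => //.
  rewrite map_inj_in_uniq // => -[t l] [t' l'] /Hys[/Hzs /= [t1 l1 p0] _].
  move=> /Hys[/Hzs /= [_ _ p0'] _] tt'; rewrite -tt' in p0' *; congr (_, _).
  have p2t : p2.[t] != 0.
    by apply: contraNneq (p1n0 t t1) => p20; rewrite -p0 /peval p20 mulr0 addr0.
  apply: (mulIf p2t); apply: (addrI p1.[t]); exact: etrans p0 (esym p0').
move=> t; apply/mapP/idP => [[w /Hys[/Hzs[t1 l1 p0] lim] ->]|/Hrt[t1 D0]].
  apply/Hrt; split=> //; rewrite hornerD hornerN hornerZ.
  by rewrite (lim_eq _ _ _ t1 l1 p0 lim) subrr.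
have q2E : (refl n p2).[t] = alpha * p1.[t].
  by move: D0; rewrite hornerD hornerN hornerZ => /subr0_eq.
have p12 : `|p2.[t]| = `|p1.[t]|.
  move: q2E; rewrite horner_refl // => /(congr1 (fun x => `|x|)).
  by rewrite !normrM normrX al1 t1 expr1n !mul1r norm_conjC.
have p2t : p2.[t] != 0 by rewrite -normr_eq0 p12 normr_eq0 p1n0.
(* The only candidate for a zero of p above [t]; it is unimodular because D(t) = 0 gives
   [|p1| = |p2|] at [t]. *)
pose l := - p1.[t] / p2.[t].
have l1 : `|l| = 1 by rewrite /l mulNr normrN normrM normfV p12 divff // normr_eq0 p1n0.
have p0 : peval p1 p2 t l = 0 by rewrite /peval divfK // subrr.
have [L [_ lim]] := Hlim t l t1 l1.
have LE : L = alpha.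
  by apply: (mulIf (p1n0 t t1)); rewrite -q2E (lim_eq _ _ _ t1 l1 p0 lim).
exists (t, l) => //; apply/Hys; split; first by apply/Hzs.
by rewrite -LE.
Qed.

(** On the torus the equation reads [z2 N = D]. If the gcd vanishes at [z1] it is void, which gives
    a vertical line; otherwise D is nonzero there and the equation becomes [z2 = 1 / B], the
    conjugate of B. *)
Lemma level_set (R : realType) n (alpha z1 z2 : R[i]) (p1 p2 : {poly R[i]}) d :
  (size p1 <= n.+1)%N -> (size p2 <= n.+1)%N -> `|alpha| = 1 ->
  Bden0 n alpha p1 p2 != 0 ->
  blaschke_of (Bnum n alpha p1 p2) (Bden n alpha p1 p2) d ->
  [/\ `|z1| = 1, `|z2| = 1 &
      peval (refl n p2) (refl n p1) z1 z2 = alpha * peval p1 p2 z1 z2] <->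
  (`|z1| = 1 /\ z2 = (Bval n alpha p1 p2 z1)^*) \/
  [/\ `|z1| = 1, `|z2| = 1 & (Bden0 n alpha p1 p2).[z1] = 0].
Proof.
move=> s1 s2 al1 D0 bl.
set N := Bnum0 n alpha p1 p2; set D := Bden0 n alpha p1 p2 in D0 *.
set g := gcdp N D.
have NB : Bnum n alpha p1 p2 * g = N by rewrite divpK // dvdp_gcdl.
have DB : Bden n alpha p1 p2 * g = D by rewrite divpK // dvdp_gcdr.
have cop : coprimep (Bnum n alpha p1 p2) (Bden n alpha p1 p2).
  by apply: coprimep_div_gcd; rewrite D0 orbT.
have curve : [/\ `|z1| = 1, `|z2| = 1 &
    peval (refl n p2) (refl n p1) z1 z2 = alpha * peval p1 p2 z1 z2] <->
    [/\ `|z1| = 1, `|z2| = 1 & z2 * N.[z1] = D.[z1]].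
  rewrite /N /D /Bnum0 /Bden0 /peval !(hornerD, hornerN, hornerZ).
  by split=> -[t1 l1 /eqP]; rewrite -subr_eq0 => /eqP E; split=> //;
    apply/eqP; rewrite -subr_eq0 -E; apply/eqP; ring.
have [gz0|gz] := eqVneq g.[z1] 0.
  have Nz : N.[z1] = 0 by rewrite -NB hornerM gz0 mulr0.
  have Dz : D.[z1] = 0 by rewrite -DB hornerM gz0 mulr0.
  rewrite curve Nz Dz mulr0; split=> [[]|[[t1 ->]|[]]]; first by right.
    by split; rewrite // norm_conjC normrM normfV; have [d0 ->] :=
      blaschke_circle bl cop t1; rewrite divff // normr_eq0.
  by split.
have Dz0 : `|z1| = 1 -> D.[z1] != 0.
  by move=> /(blaschke_circle bl cop)[d0 _]; rewrite -DB hornerM mulf_neq0.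
have zE : `|z1| = 1 -> z2 * N.[z1] = D.[z1] <-> z2 = (Bval n alpha p1 p2 z1)^*.
  move=> /(blaschke_circle bl cop)[d0 nd]; rewrite -NB -DB !hornerM mulrA.
  have n0 : (Bnum n alpha p1 p2).[z1] != 0 by rewrite -normr_eq0 nd normr_eq0.
  have B1 : `|Bval n alpha p1 p2 z1| = 1.
    by rewrite normrM normfV nd divff // normr_eq0.
  rewrite (conjE_circle B1) /Bval invf_div.
  split=> [/(mulIf gz) <-|->]; first by rewrite mulfK.
  by rewrite divfK.
rewrite curve; split=> [[t1 _ /(zE t1) E]|[[t1 E]|[t1 _ Dz]]].
- by left.
- split; [exact: t1| |exact/(zE t1)].
  have [d0 nd] := blaschke_circle bl cop t1.
  by rewrite E norm_conjC normrM normfV nd divff // normr_eq0.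
- by have := Dz0 t1; rewrite Dz eqxx.
Qed.

Theorem theorem3p3 (R : realType) (n : nat) (p1 p2 : {poly R[i]})
    (zs : seq (R[i] * R[i])) (alpha : R[i]) :
  (0 < n)%N ->
  (* p = p1(z1) + z2 p2(z1) has degree <= n in z1, <= 1 in z2 *)
  (size p1 <= n.+1)%N -> (size p2 <= n.+1)%N ->
  (* p has no zeros on D^2 *)
  (forall z1 z2 : R[i], `|z1| < 1 -> `|z2| < 1 -> peval p1 p2 z1 z2 != 0) ->
  (* p~ = z2 p~1(z1) + p~2(z1) has degree exactly (n,1) *)
  refl n p1 != 0 ->
  (size (refl n p1) = n.+1 \/ size (refl n p2) = n.+1) ->
  (* p and p~ have no common factor *)
  no_common_factor (bipoly p1 p2) (bipoly (refl n p2) (refl n p1)) ->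
  (* zs lists the (distinct) zeros of p on T^2 *)
  uniq zs ->
  (forall w, w \in zs <->
     [/\ `|w.1| = 1, `|w.2| = 1 & peval p1 p2 w.1 w.2 = 0]) ->
  (* the non-tangential limit phi^* exists and is unimodular on T^2 *)
  (forall w1 w2 : R[i], `|w1| = 1 -> `|w2| = 1 ->
     exists L : R[i], `|L| = 1 /\ ntlim (phi n p1 p2) w1 w2 L) ->
  `|alpha| = 1 ->
  let Cset := fun z1 z2 : R[i] =>
    [/\ `|z1| = 1, `|z2| = 1 &
        peval (refl n p2) (refl n p1) z1 z2 = alpha * peval p1 p2 z1 z2] in
  let Eset := fun z1 z2 : R[i] =>
    `|z1| = 1 /\ z2 = (Bval n alpha p1 p2 z1)^* in
  [/\ (* (i) *)
      (exists d : nat, blaschke_of (Bnum n alpha p1 p2) (Bden n alpha p1 p2) d),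
      (* (ii) generic alpha *)
      ((forall w, w \in zs -> ~ ntlim (phi n p1 p2) w.1 w.2 alpha) ->
         blaschke_of (Bnum n alpha p1 p2) (Bden n alpha p1 p2) n /\
         (forall z1 z2 : R[i], Cset z1 z2 <-> Eset z1 z2))
    & (* (iii) exceptional alpha: ys = the zeros (tau_k, lambda_k) with phi^* = alpha *)
      (forall ys : seq (R[i] * R[i]), uniq ys -> ys != [::] ->
         (forall w, w \in ys <-> w \in zs /\ ntlim (phi n p1 p2) w.1 w.2 alpha) ->
         blaschke_of (Bnum n alpha p1 p2) (Bden n alpha p1 p2) (n - size ys) /\
         (forall z1 z2 : R[i], Cset z1 z2 <->
            (Eset z1 z2 \/ exists2 w, w \in ys & z1 = w.1 /\ `|z2| = 1)))].

Proof.
move=> n0 s1 s2 pn0 q1 degp ncf uzs Hzs Hlim al1 Cset Eset.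
have Dout := outer_Bden0 pn0 s1 s2 al1 q1 ncf.
have p1n0 t (t1 : `|t| = 1) := p1_neq0_circle pn0 s1 s2 ncf t1.
have D0 : Bden0 n alpha p1 p2 != 0.
  by apply: contraNneq (Dout 0 _) => [->|]; rewrite ?horner0 ?normr0 ?ltr01.
have [rt [bl Hrt simple]] := blaschke_Bnum s1 s2 al1 Dout.
have urt : uniq rt.
  apply/negPn/negP => /simple[t [t1 dD dN]].
  exact: (Bden0_simple_zero pn0 s1 s2 al1 Dout t1 (p1n0 t t1) dD dN).
(* An empty [ys] is the generic case, so (ii) and (iii) are both instances. *)
have main ys : uniq ys ->
    (forall w, w \in ys <-> w \in zs /\ ntlim (phi n p1 p2) w.1 w.2 alpha) ->
    blaschke_of (Bnum n alpha p1 p2) (Bden n alpha p1 p2) (n - size ys) /\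
    (forall z1 z2 : R[i], Cset z1 z2 <->
      (Eset z1 z2 \/ exists2 w, w \in ys & z1 = w.1 /\ `|z2| = 1)).
  move=> uys Hys.
  have ys_rt := simple_zeros_perm pn0 s1 s2 al1 p1n0 Hzs Hlim Hys Hrt uys urt.
  split; first by rewrite -(size_map fst) (perm_size ys_rt).
  move=> z1 z2; rewrite /Cset (level_set z1 z2 s1 s2 al1 D0 bl).
  suff -> : [/\ `|z1| = 1, `|z2| = 1 & (Bden0 n alpha p1 p2).[z1] = 0] <->
    exists2 w, w \in ys & z1 = w.1 /\ `|z2| = 1 by [].
  split=> [[t1 l1 Dz]|[w wys [-> l1]]].
    have : z1 \in map fst ys by rewrite (perm_mem ys_rt); apply/Hrt.
    by case/mapP => w wys ->; exists w.
  have /Hrt[t1 Dz] : w.1 \in rt by rewrite -(perm_mem ys_rt) map_f.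
  by split.
split; first by exists (n - size rt)%N.
- move=> generic; have [//|w|bl0 C0] := main [::].
    by split=> // -[wz] /(generic _ wz).
  split; first by rewrite subn0 in bl0.
  by move=> z1 z2; rewrite C0; split=> [[//|[]]|]; last left.
- by move=> ys uys _; apply: main.
Qed.
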